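(* Let $J\in\{1,2,\dots\}$ and let $g^1,\dots,g^J,\gamma^1,\dots,\gamma^J\in\mathbb{C}^N$. If $$\sum_{j=1}^J\langle T_i\gamma^j,T_ig^j\rangle\neq 0,\qquad\forall i=1,\dots,N,$$ then for every $f\in\mathbb{C}^N$, $$f(i)=\frac{1}{N\sum_{j=1}^J\langle T_i\gamma^j,T_ig^j\rangle}\sum_{j=1}^J\sum_{n=1}^N\sum_{k=0}^{N-1}\langle f,g^j_{n,k}\rangle\,\gamma^j_{n,k}(i),\qquad\forall i=1,\dots,N.$$
   Context: Let $G=(V,E)$ be a finite, connected, undirected, weighted simple graph with vertex set $V=\{1,\dots,N\}$, and let $W=(W_{ij})$ be its weighted adjacency matrix: real, symmetric, zero diagonal, $W_{ij}\ge 0$, with $W_{ij}\neq0$ exactly when $i,j$ are adjacent. Let $D=\operatorname{diag}(d_1,\dots,d_N)$ with $d_i=\sum_{j}W_{ij}$, and let $\mathcal{L}=D-W$ be the graph Laplacian. Fix an orthonormal basis $(\chi_0,\dots,\chi_{N-1})$ of $\mathbb{C}^N$ consisting of eigenvectors of $\mathcal{L}$, ordered so that the eigenvalues satisfy $0=\lambda_0<\lambda_1\le\dots\le\lambda_{N-1}$ (so $|\chi_0(i)|=1/\sqrt N$ for all $i$). Signals are vectors $f=(f(1),\dots,f(N))\in\mathbb{C}^N$; the inner product $\langle f,h\rangle=\sum_{i=1}^N f(i)\overline{h(i)}$ is conjugate-linear in the second argument. Graph Fourier transform: $\hat f(\ell)=\langle f,\chi_\ell\rangle$, $\ell=0,\dots,N-1$.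 Generalized translation, for $n\in\{1,\dots,N\}$: $(T_nf)(i)=\sqrt N\sum_{\ell=0}^{N-1}\hat f(\ell)\overline{\chi_\ell(n)}\chi_\ell(i)$. Generalized modulation, for $k\in\{0,\dots,N-1\}$: $(M_kf)(i)=\sqrt N f(i)\chi_k(i)$. Windowed graph Fourier atoms: $g^j_{n,k}=M_kT_ng^j$ and $\gamma^j_{n,k}=M_kT_n\gamma^j$ (the superscript $j$ is an index, not a power). *)

(* Defs.v *)
From mathcomp Require Import all_boot all_order all_algebra.
From mathcomp Require Import reals.
From mathcomp.real_closed Require Import complex.

Set Implicit Arguments.
Unset Strict Implicit.
Unset Printing Implicit Defensive.

Import Order.TTheory GRing.Theory Num.Theory.
Local Open Scope ring_scope.
Local Open Scope complex_scope.

(* Vertices are indexed by 'I_N, i.e. 0, ..., N-1 instead of 1, ..., N. *)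
Record connected_weighted_graph (R : realType) (N : nat)
    (adj : rel 'I_N) (W : 'M[R]_N) : Prop := ConnectedWeightedGraph {
  adj_sym : symmetric adj;
  adj_irr : irreflexive adj;
  adj_connected : forall i j, connect adj i j;
  weight_sym : forall i j, W i j = W j i;
  weight_diag : forall i, W i i = 0;
  weight_ge0 : forall i j, 0 <= W i j;
  weight_supp : forall i j, (W i j != 0) = adj i j
}.

Definition degree (R : realType) (N : nat) (W : 'M[R]_N) (i : 'I_N) : R :=
  \sum_(j < N) W i j.

Definition laplacian (R : realType) (N : nat) (W : 'M[R]_N) : 'M[R]_N :=
  diag_mx (\row_i degree W i) - W.

Definition inner (R : realType) (N : nat) (f h : 'cV[R[i]]_N) : R[i] :=
  \sum_(i < N) f i 0 * (h i 0)^*.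

(* The real matrix L acts on C^N through the embedding of R into R[i]. *)
Record laplacian_eigenbasis (R : realType) (N : nat) (W : 'M[R]_N)
    (lambda : 'I_N -> R) (chi : 'I_N -> 'cV[R[i]]_N) : Prop :=
  LaplacianEigenbasis {
  chi_basis : basis_of fullv [tuple chi l | l < N];
  chi_orthonormal : forall l m, inner (chi l) (chi m) = (l == m)%:R;
  chi_eigen : forall l,
    map_mx (real_complex R) (laplacian W) *m chi l = (lambda l)%:C *: chi l;
  lambda_le : forall l m : 'I_N, (l <= m)%N -> lambda l <= lambda m;
  lambda_eq0 : forall l : 'I_N, l = 0%N :> nat -> lambda l = 0;
  lambda_gt0 : forall l : 'I_N, (0 < l)%N -> 0 < lambda l
}.

Section GraphTransforms.

Variables (R : realType) (N : nat) (chi : 'I_N -> 'cV[R[i]]_N).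
Implicit Types f g : 'cV[R[i]]_N.

Definition gft f (l : 'I_N) : R[i] := inner f (chi l).

Definition translation (n : 'I_N) f : 'cV[R[i]]_N :=
  \col_i (sqrtC N%:R * \sum_(l < N) gft f l * (chi l n 0)^* * chi l i 0).

Definition modulation (k : 'I_N) f : 'cV[R[i]]_N :=
  \col_i (sqrtC N%:R * f i 0 * chi k i 0).

Definition atom g (n k : 'I_N) : 'cV[R[i]]_N :=
  modulation k (translation n g).

End GraphTransforms.

(* Main.v *)
Require Import Defs.
From mathcomp Require Import all_boot all_order all_algebra.
From mathcomp Require Import reals ring.
From mathcomp.real_closed Require Import complex.

Set Implicit Arguments.
Unset Strict Implicit.
Unset Printing Implicit Defensive.

Import Order.TTheory GRing.Theory Num.Theory.
Local Open Scope ring_scope.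
Local Open Scope complex_scope.

(** Expand the coefficients [inner f (atom chi g n k)] as sums over a vertex
    [m] and sum over the frequency [k] first.  The only dependence on [k] is
    through [chi k i 0 * (chi k m 0)^*], and completeness of the basis
    ([orthonormal_complete]) turns that sum into a Kronecker delta, so that
    only [m = i] survives: a single window pair contributes
    [N * f i * (T_n gamma)(i) * ((T_n g)(i))^*] for each vertex [n]
    ([sum_frequency_atoms]).

    It remains to sum over [n].  The summand has [n] as the centre and [i] as
    the point of evaluation, whereas the normalising constant
    [inner (T_i gamma) (T_i g)] has the two roles exchanged.  Both are
    nevertheless equal to
    [N * \sum_l gft gamma l * (gft g l)^* * |chi l i|^2]
    by Parseval's identity, because exchanging centre and evaluation point only
    moves a conjugation from one factor [chi l] to the other
    ([sum_translation_centers]).  Summing over the windows gives [f i] times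
    the constant in the denominator. *)

Lemma conj_sqrtC_nat_mul (R : realType) (N : nat) :
  sqrtC N%:R * (sqrtC N%:R)^* = N%:R :> R[i].
Proof.
by rewrite geC0_conj ?sqrtC_ge0 ?ler0n // -expr2 sqrtCK.
Qed.

Section OrthonormalFamily.

Variables (R : realType) (N : nat) (chi : 'I_N -> 'cV[R[i]]_N).
Hypothesis chi_on : forall l m, inner (chi l) (chi m) = (l == m)%:R.
Implicit Types (f g h : 'cV[R[i]]_N) (a b : 'I_N -> R[i]).

(** The square matrix with rows [chi l] has its conjugate transpose as right
    inverse, hence also as left inverse. *)
Lemma orthonormal_complete i m :
  \sum_(k < N) chi k i 0 * (chi k m 0)^* = (i == m)%:R.
Proof.
pose U : 'M[R[i]]_N := \matrix_(l, p) chi l p 0.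
pose V : 'M[R[i]]_N := \matrix_(p, l) (chi l p 0)^*.
have /mulmx1C VU : U *m V = 1%:M.
  apply/matrixP=> l k; rewrite !mxE -chi_on /inner.
  by apply: eq_bigr => p _; rewrite !mxE.
have := congr1 (fun A : 'M_N => A m i) VU; rewrite !mxE eq_sym => <-.
by apply: eq_bigr => k _; rewrite !mxE mulrC.
Qed.

Lemma orthonormal_parseval a b :
  \sum_(m < N) (\sum_(l < N) a l * chi l m 0)
             * (\sum_(l < N) b l * chi l m 0)^*
  = \sum_(l < N) a l * (b l)^*.
Proof.
under eq_bigr => m _ do rewrite rmorph_sum big_distrlr /=.
rewrite exchange_big; apply: eq_bigr => l _ /=.
transitivity (\sum_(k < N) a l * (b k)^* * (l == k)%:R).
  rewrite exchange_big; apply: eq_bigr => k _ /=.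
  rewrite -chi_on mulr_sumr.
  by apply: eq_bigr => m _; rewrite rmorphM /=; ring.
rewrite (bigD1 l) //= eqxx mulr1 big1 ?addr0 // => k kl.
by rewrite eq_sym (negPf kl) mulr0.
Qed.

Lemma inner_translation h g i :
  inner (translation chi i h) (translation chi i g)
  = N%:R * \sum_(l < N) gft chi h l * (gft chi g l)^*
                        * (chi l i 0 * (chi l i 0)^*).
Proof.
transitivity (N%:R * \sum_(l < N) (gft chi h l * (chi l i 0)^*)
                                  * (gft chi g l * (chi l i 0)^*)^*).
  rewrite -orthonormal_parseval -conj_sqrtC_nat_mul mulr_sumr.
  by apply: eq_bigr => m _; rewrite !mxE rmorphM /=; ring.
by congr (_ * _); apply: eq_bigr => l _; rewrite rmorphM /= conjCK; ring.
Qed.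

(** As functions of the centre [n], the values at [i] are the conjugates of
    combinations of the basis; conjugating lets Parseval's identity apply. *)
Lemma sum_translation_centers h g i :
  \sum_(n < N) translation chi n h i 0 * (translation chi n g i 0)^*
  = inner (translation chi i h) (translation chi i g).
Proof.
have conj_center u n :
    (\sum_(l < N) gft chi u l * (chi l n 0)^* * chi l i 0)^*%R
    = \sum_(l < N) (gft chi u l * chi l i 0)^* * chi l n 0.
  rewrite rmorph_sum; apply: eq_bigr => l _.
  by rewrite !rmorphM /= conjCK; ring.
rewrite inner_translation.
transitivity (N%:R * \sum_(l < N) (gft chi g l * chi l i 0)^*
                                  * ((gft chi h l * chi l i 0)^*)^*).
  rewrite -[in RHS]orthonormal_parseval -conj_sqrtC_nat_mul mulr_sumr.
  apply: eq_bigr => n _.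
  by rewrite -!conj_center conjCK !mxE rmorphM /=; ring.
by congr (_ * _); apply: eq_bigr => l _; rewrite conjCK rmorphM /=; ring.
Qed.

(** Completeness collapses the frequency sum: modulating by every basis vector
    isolates the value of [f] times the window at the point [i]. *)
Lemma sum_frequency_atoms f g h n i :
  \sum_(k < N) inner f (atom chi g n k) * atom chi h n k i 0
  = N%:R * f i 0
    * (translation chi n h i 0 * (translation chi n g i 0)^*).
Proof.
pose c m := N%:R * f m 0
            * (translation chi n h i 0 * (translation chi n g m 0)^*).
transitivity (\sum_(m < N) c m * (i == m)%:R).
  under [RHS]eq_bigr => m _ do rewrite -orthonormal_complete mulr_sumr.
  rewrite exchange_big; apply: eq_bigr => k _ /=.
  rewrite mulr_suml; apply: eq_bigr => m _.
  rewrite /c /atom -conj_sqrtC_nat_mul.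
  (* The translates stay opaque so that [mxE] only unfolds the modulation. *)
  move: (translation chi n h) (translation chi n g) => H G.
  by rewrite !mxE !rmorphM /=; ring.
rewrite (bigD1 i) //= eqxx mulr1 big1 ?addr0 // => m mi.
by rewrite eq_sym (negPf mi) mulr0.
Qed.

End OrthonormalFamily.

Theorem theorem4p1 (R : realType) (N : nat) (hN : (0 < N)%N)
    (adj : rel 'I_N) (W : 'M[R]_N) (hG : connected_weighted_graph adj W)
    (lambda : 'I_N -> R) (chi : 'I_N -> 'cV[R[i]]_N)
    (hchi : laplacian_eigenbasis W lambda chi)
    (J : nat) (hJ : (0 < J)%N) (g gamma : 'I_J -> 'cV[R[i]]_N)
    (hne : forall i : 'I_N,
      \sum_(j < J)
        inner (translation chi i (gamma j)) (translation chi i (g j)) != 0)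
    (f : 'cV[R[i]]_N) (i : 'I_N) :
  f i 0 =
    1 / (N%:R * \sum_(j < J)
           inner (translation chi i (gamma j)) (translation chi i (g j))) *
    \sum_(j < J) \sum_(n < N) \sum_(k < N)
      inner f (atom chi (g j) n k) * atom chi (gamma j) n k i 0.
Proof.
have chi_on := chi_orthonormal hchi.
have N_neq0 : N%:R != 0 :> R[i] by rewrite pnatr_eq0 -lt0n.
set S := (X in N%:R * X).
have S_neq0 : S != 0 by exact: hne.
have -> : \sum_(j < J) \sum_(n < N) \sum_(k < N)
    inner f (atom chi (g j) n k) * atom chi (gamma j) n k i 0
    = N%:R * f i 0 * S.
  rewrite mulr_sumr; apply: eq_bigr => j _.
  rewrite -(sum_translation_centers chi_on) mulr_sumr.
  by apply: eq_bigr => n _; rewrite (sum_frequency_atoms chi_on).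
by field; rewrite N_neq0 S_neq0.
Qed.
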